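(* Let $y_0\in V(0)$ be a minimal point of $(P(0))$ and let $\mathcal L_{y_0}$ be the Lagrange process of $(P(0))$ at $y_0$. Assume: there exists $x_1\in\Omega$ with $G(x_1)\cap(-\mathrm{int}(Z_+))\ne\emptyset$; the set $Y_+\cap S_Y$ is compact, where $S_Y$ is the unit sphere of $Y$; and $V$ is $Y_+$-dominated by $M$ near $0$. If any of the following conditions holds: (a) $\mathrm{Graph}(\mathcal L_{y_0})$ has a bounded base; (b) $Y_+\setminus\{0\}$ is open; (c) $y_0\in\mathrm{GHe}(V(0))$; (d) $y_0\in\mathrm{He}(V(0))$; then $$\mathrm{Min}\,DM(0,y_0)(z)=\mathrm{Min}\,\mathcal L_{y_0}(-z)\qquad\text{for all } z\in Z,$$ where $DM(0,y_0)$ is the contingent derivative of $M$ at $(0,y_0)$.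
   Context: Setting. $X,Y,Z$ are real normed spaces with topological duals $X^*,Y^*,Z^*$. $Y_+\subset Y$ and $Z_+\subset Z$ are convex cones (a cone is a nonempty set $K$ with $\alpha K\subset K$ for all real $\alpha\ge 0$) which are proper ($\{0\}\ne K$ and $K$ is not the whole space) and solid (nonempty interior); moreover $Y_+$ is pointed: $Y_+\cap(-Y_+)=\{0\}$. $\Omega\subset X$ is a nonempty convex set, $F:\Omega\rightrightarrows Y$ and $G:\Omega\rightrightarrows Z$ are set-valued maps, $F$ is $Y_+$-convex (i.e. $\{(x,y): x\in\Omega,\ y\in F(x)+Y_+\}$ is convex) and $G$ is $Z_+$-convex. Sums of sets are Minkowski sums, with $A+\emptyset=\emptyset$. For a set-valued map $H$, $\mathrm{Graph}(H)=\{(u,v): v\in H(u)\}$, $\mathrm{Dom}(H)=\{u: H(u)\ne\emptyset\}$, $H(A)=\bigcup_{a\in A}H(a)$ for $A\subset\mathrm{Dom}(H)$. The parametric problem $(P(z))$, $z\in Z$, is: Min $F(x)$ such that $x\in\Omega$, $G(x)\cap(z-Z_+)\ne\emptyset$. Put $S(z)=\{x\in\Omega: G(x)\cap(z-Z_+)\neq\emptyset\}$ (assumed contained in $\mathrm{Dom}(F)$, so that the next image is defined), $V(z)=F(S(z))$, $(V+Y_+)(z)=V(z)+Y_+$, $M(z)=\mathrm{Min}(V(z))$, where $\mathrm{Min}(A)=\{y\in A: A\cap(y-Y_+)=\{y\}\}$; these give set-valued maps $V,\,V+Y_+,\,M:Z\rightrightarrows Y$. A minimal point of $(P(0))$ is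 an element of $M(0)$. $V$ is $Y_+$-dominated by $M$ near $0$ if there is a neighbourhood $V_0$ of $0$ in $Z$ with $V(z)\subseteq M(z)+Y_+$ for every $z\in V_0$. $\mathcal S_{Y_+}(y_0)$ is the set of $(z^*,y^* )\in Z^*\times Y^*$ with $\langle z^*,z'\rangle+\langle y^*,y'\rangle\le\langle y^*,y_0\rangle\le\langle z^*,z\rangle+\langle y^*,y\rangle$ for all $(z',y')\in(-Z_+)\times(y_0-Y_+)$ and all $(z,y)\in\mathrm{Graph}(V+Y_+)$. The Lagrange process of $(P(0))$ at $y_0$ is the closed convex process (set-valued map with closed convex cone graph) $\mathcal L_{y_0}:Z\rightrightarrows Y$ given by $\mathcal L_{y_0}(z)=\{y\in Y:\langle z^*,z\rangle\le\langle y^*,y\rangle\ \text{for all }(z^*,y^* )\in\mathcal S_{Y_+}(y_0)\}$. For a nonempty subset $A$ of a normed space and $u\in\mathrm{cl}(A)$, the contingent cone is $T_A(u)=\{v:\liminf_{h\to0+}d(A,u+hv)/h=0\}$, $d$ being the distance induced by the norm. For a set-valued map $H:Z\rightrightarrows Y$ and $(z_0,y_0)\in\mathrm{Graph}(H)$, the contingent derivative $DH(z_0,y_0):Z\rightrightarrows Y$ is defined by $\mathrm{Graph}(DH(z_0,y_0))=T_{\mathrm{Graph}(H)}(z_0,y_0)$ ($Z\times Y$ with a product norm). $\mathrm{cone}(A)=\{\lambda a:\lambda\ge0,\ a\in A\}$. A base of a convex cone $K$ is a nonempty convex set $\Theta\subset K$ with $0\notin\mathrm{cl}(\Theta)$ and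 $K=\mathrm{cone}(\Theta)$. $B_Y$ is the closed unit ball of $Y$. For $A\subset Y$ and $\bar y\in A$: $\bar y\in\mathrm{GHe}(A)$ (Henig global properly efficient) if there is a pointed cone $\mathcal K\subset Y$ with $Y_+\setminus\{0\}\subset\mathrm{int}(\mathcal K)$ and $(A-\bar y)\cap(-\mathrm{int}(\mathcal K))=\emptyset$; $\bar y\in\mathrm{He}(A)$ (Henig properly efficient) if for some base $\Theta$ of $Y_+$ there is $\varepsilon>0$ with $\mathrm{cl}(\mathrm{cone}(A-\bar y))\cap(-\mathrm{cl}(\mathrm{cone}(\Theta+\varepsilon B_Y)))=\{0\}$. *)

(* Defs.v *)
From HB Require Import structures.
From mathcomp Require Import all_boot all_order all_algebra.
From mathcomp Require Import all_classical all_reals all_analysis.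

Set Implicit Arguments.
Unset Strict Implicit.
Unset Printing Implicit Defensive.

Import Order.TTheory GRing.Theory Num.Theory.
Import numFieldNormedType.Exports.

Local Open Scope classical_set_scope.
Local Open Scope ring_scope.

Section SetsAndCones.
Context {R : realType} {E : normedModType R}.
Implicit Types (A B K T : set E) (u v y : E).

Definition minkowski_sum A B : set E := [set a + b | a in A & b in B].

Definition set_opp A : set E := [set - a | a in A].

Definition is_cone K : Prop :=
  K !=set0 /\ forall (a : R) v, 0 <= a -> K v -> K (a *: v).

Definition is_proper K : Prop := K <> [set 0] /\ K <> setT.

Definition is_solid K : Prop := interior K !=set0.

Definition is_pointed K : Prop := K `&` set_opp K = [set 0].

Definition cone A : set E :=
  [set v | exists (l : R) a, [/\ 0 <= l, A a & v = l *: a]].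

Definition is_base T K : Prop :=
  [/\ T !=set0, convex_set T, T `<=` K, ~ closure T 0 & K = cone T].

(* [edist_inf A] is the library's extended distance to [A], defined through
   balls; [edist_inf_norm] below identifies it with the infimum of norms. *)
Definition contingent_cone A u : set E :=
  [set v : E | limf_einf (fun h : R => edist_inf A (u + h *: v)%R / h%:E)%E
                 0^'+ = 0%E].

Lemma edist_inf_norm A u :
  edist_inf A u = ereal_inf [set (`|u - a|)%:E | a in A].
Proof.
rewrite /edist_inf; congr ereal_inf; apply: eq_imagel => a _.
apply/eqP; rewrite eq_le; apply/andP; split.
  apply/lee_addgt0Pr => e e0; rewrite -EFinD; apply: edist_fin => /=.
    by rewrite ltr_wpDl.
  by rewrite -ball_normE /= ltrDl.
apply: le_ereal_inf_tmp => _ [r [r0 /= ar] <-].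
by rewrite lee_fin ltW //; move: ar; rewrite -ball_normE.
Qed.

End SetsAndCones.

Section Efficiency.
Context {R : realType} {Y : normedModType R}.
Implicit Types (Yp A : set Y) (y : Y).

Definition Min Yp A : set Y :=
  [set y | A y /\ A `&` minkowski_sum [set y] (set_opp Yp) = [set y]].

Definition unit_ball : set Y := [set b | `|b| <= 1].

Definition GHe Yp A : set Y :=
  [set y | A y /\ exists K : set Y,
    [/\ is_cone K, is_pointed K, Yp `\ 0 `<=` interior K &
        minkowski_sum A [set - y] `&` set_opp (interior K) = set0]].

Definition He Yp A : set Y :=
  [set y | A y /\ exists T : set Y, is_base T Yp /\
    exists2 e : R, 0 < e &
      closure (cone (minkowski_sum A [set - y])) `&`
      set_opp (closure (cone (minkowski_sum T [set e *: b | b in unit_ball]))) =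
      [set 0]].

End Efficiency.

Section SetValuedMaps.
Context {R : realType} {U W : normedModType R}.
Implicit Types (H : U -> set W) (D : set U).

Definition graph H : set (U * W) := [set p | H p.1 p.2].

Definition contingent_derivative H (p : U * W) : U -> set W :=
  fun u => [set w | contingent_cone (graph H) p (u, w)].

(* A set-valued map defined on a subset [D] of [U] is encoded by a total
   [H : U -> set W] whose values outside [D] are never used. *)
Definition dom_on D H : set U := [set u | D u /\ H u !=set0].

Definition cone_convex_on D H (K : set W) : Prop :=
  convex_set ([set p | D p.1 /\ minkowski_sum (H p.1) K p.2] : set (U * W)).

Definition dominated_near0 (V M : U -> set W) (K : set W) : Prop :=
  \forall z \near (0 : U), V z `<=` minkowski_sum (M z) K.

End SetValuedMaps.

Section ParametricProblem.
Context {R : realType} {X Y Z : normedModType R}.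
Variables (Omega : set X) (F : X -> set Y) (G : X -> set Z).
Variables (Yp : set Y) (Zp : set Z).

Definition feasible (z : Z) : set X :=
  [set x | Omega x /\ G x `&` minkowski_sum [set z] (set_opp Zp) !=set0].

Definition value_map (z : Z) : set Y := \bigcup_(x in feasible z) F x.

Definition upper_value_map (z : Z) : set Y := minkowski_sum (value_map z) Yp.

Definition minimal_map (z : Z) : set Y := Min Yp (value_map z).

Definition slater : Prop :=
  exists2 x1, Omega x1 & G x1 `&` set_opp (interior Zp) !=set0.

Definition dual (E : normedModType R) : set {linear E -> R^o} :=
  [set f | continuous f].

Definition multipliers (y0 : Y) : set ({linear Z -> R^o} * {linear Y -> R^o}) :=
  [set p | [/\ dual p.1, dual p.2,
    forall z' y', set_opp Zp z' -> minkowski_sum [set y0] (set_opp Yp) y' ->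
      p.1 z' + p.2 y' <= p.2 y0 &
    forall z y, graph upper_value_map (z, y) -> p.2 y0 <= p.1 z + p.2 y]].

Definition lagrange_process (y0 : Y) : Z -> set Y :=
  fun z => [set y | forall p, multipliers y0 p -> p.1 z <= p.2 y].

End ParametricProblem.

(* Main.v *)
Require Import Defs.
From HB Require Import structures.
From mathcomp Require Import all_boot all_order all_algebra.
From mathcomp Require Import all_classical all_reals all_analysis.
From mathcomp Require Import ring lra.
Import Order.TTheory GRing.Theory Num.Theory.
Import numFieldNormedType.Exports.
Local Open Scope classical_set_scope.
Local Open Scope ring_scope.

(** Write V for the value map, W = V + Yp for the upper value map, M for the
    minimal map, and let T be the closed cone generated by Graph W - (0, y0).

    Graph W is convex, so its contingent cone at (0, y0) is T
    ([contingent_cone_convex]).  The multipliers are the negatives of the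
    continuous functionals that are nonpositive on Graph W - (0, y0), so the
    bipolar theorem says that T is also the graph of z |-> L(- z)
    ([lagrange_processE], through [hahn_banach] and [cone_separation]).
    Hence DW(0, y0)(z) = L(- z), and it remains to compare DM with DW.  It is
    enough to show DW(0, y0)(z) = DM(0, y0)(z) + Yp, because adding a pointed
    convex cone to a set keeps its minimal points ([Min_minkowski_sum]).

    Near 0 domination gives W = M + Yp.  Take a tangent direction of W and
    split its difference quotients along this sum.  If the Yp-components stay
    bounded, compactness of the truncations of Yp yields a limit component and
    the rest is tangent to M.  If they are unbounded, dividing by their norms
    produces a unit vector s of Yp with (0, - s) in T
    ([contingent_derivative_decomposition]).  So everything rests on excluding
    such an s, and this is the purpose of (a)-(d).

    Under (a) it is immediate: T contains (0, s), and a cone with a base is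
    pointed.  In the other cases, Slater's condition shows that - s lies in
    the closed cone generated by W(0) - y0 ([tangent_fibre0]).  The proper
    efficiency conditions speak of V(0), and the enlarged cone of a Henig
    global efficient point may fail to be convex, so the summand Yp cannot
    simply be absorbed in it; instead, compactness and pointedness of Yp give
    another unit vector r of Yp with - r in the closed cone generated by
    V(0) - y0 ([closure_cone_minkowski_sum]).  Both kinds of Henig efficiency
    exclude such an r, and (b) turns the minimal point y0 into a Henig global
    efficient one ([open_Min_GHe]). *)

Set Implicit Arguments.
Unset Strict Implicit.
Unset Printing Implicit Defensive.

(** * The Hahn-Banach theorem *)

Section HahnBanach.
Context {R : realType} {E : lmodType R}.
Implicit Types (p q : E -> R) (x y : E).

Definition sublinear q : Prop :=
  (forall x y, q (x + y) <= q x + q y) /\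
  (forall (t : R) x, 0 < t -> q (t *: x) <= t * q x).

Lemma sublinearZ q (t : R) x : sublinear q -> 0 < t -> q (t *: x) = t * q x.
Proof.
move=> [_ qZ] t0; apply/eqP; rewrite eq_le qZ//=.
have := qZ t^-1 (t *: x); rewrite invr_gt0 scalerK ?gt_eqF// => /(_ t0).
by rewrite ler_pdivlMl.
Qed.

Lemma sublinear0 q : sublinear q -> q 0 = 0.
Proof.
move=> sq.
have : q (2 *: 0) = 2 * q 0 by apply: sublinearZ => //; rewrite ltr0n.
by rewrite scaler0; lra.
Qed.

Lemma sublinear_lbound q x : sublinear q -> - q (- x) <= q x.
Proof.
by move=> sq; have := sq.1 x (- x); rewrite subrr (sublinear0 sq); lra.
Qed.

(** The infimum over the half-line spanned by [y] keeps the value of [q] at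
    [y] but lowers the one at [- y] to [- q y]: it makes [q] linear along [y]
    while staying sublinear everywhere. *)
Definition descent q y x : R :=
  inf [set q (x + t *: y) - t * q y | t in [set t : R | 0 <= t]].

Let descent_has_inf q y x : sublinear q ->
  has_inf [set q (x + t *: y) - t * q y | t in [set t : R | 0 <= t]].
Proof.
move=> sq; split; first by exists (q (x + 0 *: y) - 0 * q y), 0 => //=.
exists (- q (- x)) => _ [t /= t0 <-].
have [<-|{}t0] : 0 = t \/ 0 < t.
  by move: t0; rewrite [0 <= t]le_eqVlt => /orP[/eqP|]; [left|right].
  by rewrite scale0r addr0 mul0r subr0 sublinear_lbound.
have := sq.1 (x + t *: y) (- x).
by rewrite [x + _]addrC addrK (sublinearZ _ sq t0); lra.
Qed.

Let descent_le q y x (t : R) : sublinear q -> 0 <= t ->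
  descent q y x <= q (x + t *: y) - t * q y.
Proof.
by move=> sq t0; apply: ge_inf; [exact: (descent_has_inf _ _ sq).2|exists t].
Qed.

Let descent_ge q y x (m : R) : sublinear q ->
  (forall t : R, 0 <= t -> m <= q (x + t *: y) - t * q y) ->
  m <= descent q y x.
Proof.
move=> sq h; apply: lb_le_inf; first exact: (descent_has_inf _ _ sq).1.
by move=> _ [t t0 <-]; exact: h.
Qed.

Lemma descent_le_self q y x : sublinear q -> descent q y x <= q x.
Proof.
by move=> sq; have := descent_le y x sq (lexx 0); rewrite scale0r addr0; lra.
Qed.

Lemma descent_leB q y x : sublinear q -> descent q y x <= q (x + y) - q y.
Proof.
by move=> sq; have := descent_le y x sq ler01; rewrite scale1r mul1r.
Qed.

Lemma sublinear_descent q y : sublinear q -> sublinear (descent q y).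
Proof.
move=> sq; split=> [x1 x2|t x t0].
  rewrite -lerBlDr; apply: descent_ge => // t t0.
  rewrite lerBlDr -lerBlDl; apply: descent_ge => // s s0.
  have := descent_le y (x1 + x2) sq (addr_ge0 t0 s0).
  rewrite scalerDl addrACA.
  by have := sq.1 (x1 + t *: y) (x2 + s *: y); lra.
rewrite -ler_pdivrMl//; apply: descent_ge => // s s0.
rewrite ler_pdivrMl//.
have := descent_le y (t *: x) sq (mulr_ge0 (ltW t0) s0).
rewrite -scalerA -scalerDr (sublinearZ _ sq t0); nra.
Qed.

(** In a chain the smaller of two members lies below both, which is what
    subadditivity of the pointwise infimum requires; the bound by [q] keeps
    that infimum finite. *)
Let sublinear_inf_chain q (A : set (E -> R)) :
  (forall p, A p -> sublinear p /\ forall x, p x <= q x) ->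
  A !=set0 ->
  (forall p p', A p -> A p' ->
    (forall x, p' x <= p x) \/ (forall x, p x <= p' x)) ->
  let m x := inf [set p x | p in A] in
  [/\ sublinear m, (forall x, m x <= q x) &
      forall p, A p -> forall x, m x <= p x].
Proof.
move=> Aq A0 Atot m.
have mh x : has_inf [set p x | p in A].
  split; first by case: A0 => p Ap; exists (p x), p.
  exists (- q (- x)) => _ [p Ap <-]; have [sp pq] := Aq p Ap.
  by have := sublinear_lbound x sp; have := pq (- x); lra.
have mle p x : A p -> m x <= p x.
  by move=> Ap; apply: ge_inf; [exact: (mh x).2|exists p].
have mge c x : (forall p, A p -> c <= p x) -> c <= m x.
  move=> h; apply: lb_le_inf; first exact: (mh x).1.
  by move=> _ [p Ap <-]; exact: h.
split=> [|x|p Ap x]; last exact: mle.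
  split=> [x y|t x t0].
    rewrite -lerBlDr; apply/mge => p Ap.
    rewrite lerBlDr -lerBlDl; apply/mge => p' Ap'; rewrite lerBlDl.
    case: (Atot p p' Ap Ap') => [p'p|pp'].
      have := mle p' (x + y) Ap'; have := (Aq p' Ap').1.1 x y.
      by have := p'p x; lra.
    have := mle p (x + y) Ap; have := (Aq p Ap).1.1 x y.
    by have := pp' y; lra.
  rewrite -ler_pdivrMl//; apply/mge => p Ap; rewrite ler_pdivrMl//.
  by have := mle p (t *: x) Ap; have := (Aq p Ap).1.2 t x t0; lra.
case: A0 => p Ap; have := mle p x Ap; have := (Aq p Ap).2 x; lra.
Qed.

(** Zorn's lemma reaches a minimal sublinear functional; no descent can lower
    it further, so it is additive in every direction. *)
Lemma exists_linear_le q : sublinear q ->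
  exists f : {linear E -> R^o}, forall x, f x <= q x.
Proof.
move=> sq.
pose P p := sublinear p /\ forall x, p x <= q x.
pose T := {p : E -> R | P p}.
pose r (p p' : T) := `[< forall x, sval p' x <= sval p x >].
have [| | | |p pmin] := @Zorn T r.
- by move=> t; apply/asboolP.
- move=> a b c /asboolP ab /asboolP bc; apply/asboolP => x.
  exact: le_trans (bc x) (ab x).
- move=> [a ha] [b hb] /asboolP/= ab /asboolP/= ba; apply/eq_exist/funext => x.
  by apply/eqP; rewrite eq_le ba ab.
- move=> A Atot; have [->|/set0P[a0 Aa0]] := eqVneq A set0.
    by exists (exist P q (conj sq (fun x => lexx (q x)))).
  have [|||sm mq mA] := @sublinear_inf_chain q [set sval a | a in A].
  - by move=> _ [a _ <-]; exact: (svalP a).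
  - by exists (sval a0), a0.
  - move=> _ _ [a Aa <-] [b Ab <-].
    by case: (Atot a b Aa Ab) => /asboolP; [left|right].
  exists (exist P _ (conj sm mq)) => a Aa; apply/asboolP => x /=.
  by apply/mA; exists a.
have [sp pq] := svalP p; set f := sval p in sp pq.
have fdesc y x : descent f y x = f x.
  have hd : sublinear (descent f y) /\ forall x, descent f y x <= q x.
    split=> [|z]; first exact: sublinear_descent.
    by apply: le_trans (descent_le_self y z sp) (pq z).
  have /pmin/(congr1 sval)/= : r p (exist P _ hd).
    by apply/asboolP => z /=; exact: descent_le_self.
  by rewrite -/f => ->.
have fD x y : f (x + y) = f x + f y.
  apply/eqP; rewrite eq_le sp.1/=.
  by have := descent_leB y x sp; rewrite fdesc; lra.
have fN x : f (- x) = - f x.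
  by have := fD x (- x); rewrite subrr (sublinear0 sp); lra.
have fZ (t : R) x : f (t *: x) = t * f x.
  have [t0|t0|->] := ltgtP t 0.
  - rewrite -[t *: x]opprK -scaleNr fN (sublinearZ _ sp) ?oppr_gt0//; lra.
  - exact: sublinearZ.
  - by rewrite scale0r mul0r sublinear0.
have lf : linear (f : E -> R^o).
  by move=> t x y; rewrite fD fZ.
pose F := GRing.isLinear.Build R E R^o _ _ lf.
by exists (HB.pack_for {linear E -> R^o} (f : E -> R^o) F).
Qed.

(** A linear functional below the descent of [q] along [x0] is at most
    [- q x0] at [- x0], which forces equality at [x0]. *)
Theorem hahn_banach q x0 : sublinear q ->
  exists2 f : {linear E -> R^o}, (forall x, f x <= q x) & f x0 = q x0.
Proof.
move=> sq; have [f fle] := exists_linear_le (sublinear_descent x0 sq).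
exists f => [x|]; first exact: le_trans (fle x) (descent_le_self _ _ sq).
have := fle x0; have := fle (- x0); have := descent_le_self x0 x0 sq.
have := descent_leB x0 (- x0) sq.
by rewrite addNr (sublinear0 sq) linearN; lra.
Qed.

End HahnBanach.

(** * Convex cones and their separation from points *)

Section ConvexCones.
Context {R : realType} {E : lmodType R}.
Implicit Types (x y : E).

Lemma convex_set_comb (A : set E) : convex_set A ->
  forall (t : R) x y, 0 <= t <= 1 -> A x -> A y ->
  A (t *: x + (1 - t) *: y).
Proof.
move=> cA t x y /andP[t0 t1] Ax Ay.
by have := cA x y (Itv01 t0 t1) (mem_set Ax) (mem_set Ay); rewrite inE.
Qed.

Lemma convex_set_intro (A : set E) :
  (forall (t : R) x y, 0 <= t <= 1 -> A x -> A y ->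
     A (t *: x + (1 - t) *: y)) -> convex_set A.
Proof.
by move=> h x y t; rewrite !inE => Ax Ay; apply: h => //; rewrite ge0/= le1.
Qed.

End ConvexCones.

Section Cones.
Context {R : realType} {E : normedModType R}.
Implicit Types (A K : set E) (x y u v : E).

Definition add_closed K : Prop := forall x y, K x -> K y -> K (x + y).

Lemma is_cone0 K : is_cone K -> K 0.
Proof. by move=> [[x Kx] KZ]; rewrite -(scale0r x); exact: KZ. Qed.

Lemma convex_cone_add K : is_cone K -> convex_set K -> add_closed K.
Proof.
move=> [_ KZ] cK x y Kx Ky.
have -> : x + y = 2 *: (2^-1 *: x + (1 - 2^-1) *: y).
  by rewrite scalerDr !scalerA mulrBr mulr1 divff// [2 - 1]addrK !scale1r.
by apply: KZ => //; apply: convex_set_comb => //; lra.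
Qed.

Lemma cone_is_cone A : A !=set0 -> is_cone (cone A).
Proof.
move=> [a Aa]; split; first by exists a; exists 1, a; rewrite scale1r.
move=> t _ t0 [l [b [l0 Ab ->]]].
by exists (t * l), b; rewrite scalerA mulr_ge0.
Qed.

Lemma sub_cone A : A `<=` cone A.
Proof. by move=> a Aa; exists 1, a; rewrite scale1r. Qed.

Lemma cone_add A : convex_set A -> add_closed (cone A).
Proof.
move=> cA _ _ [l [a [l0 Aa ->]]] [m [b [m0 Ab ->]]].
have [lm0|lm0] := eqVneq (l + m) 0.
  have [-> ->] : l = 0 /\ m = 0 by lra.
  by exists 0, a; rewrite !scale0r addr0.
have lm_gt0 : 0 < l + m by lra.
exists (l + m), (l / (l + m) *: a + (1 - l / (l + m)) *: b).
split; first exact: ltW.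
  apply: convex_set_comb => //.
  by rewrite divr_ge0 ?ler_pdivrMr ?mul1r ?lerDl// ltW.
rewrite scalerDr !scalerA mulrBr mulr1 !mulrA mulrAC divff// mul1r.
by rewrite [l + m]addrC addrK.
Qed.

(** Convexity and [A 0] make every direction of the cone feasible for all
    small step lengths, not just for one. *)
Lemma cone_shrink A v : convex_set A -> A 0 -> cone A v ->
  exists2 d : R, 0 < d & forall h, 0 <= h <= d -> A (h *: v).
Proof.
move=> cA A0 [l [a [l0 Aa ->]]].
have [->|lN0] := eqVneq l 0.
  by exists 1 => // h _; rewrite scale0r scaler0.
have l_gt0 : 0 < l by rewrite lt_neqAle eq_sym lN0.
exists l^-1 => [|h /andP[h0 hl]]; first by rewrite invr_gt0.
have := @convex_set_comb _ _ _ cA (h * l) a 0.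
rewrite scaler0 addr0 scalerA; apply=> //.
by rewrite mulr_ge0//= -ler_pdivlMr// mul1r.
Qed.

Lemma closureP A x : closure A x <->
  forall e : R, 0 < e -> exists2 a, A a & `|x - a| < e.
Proof.
split=> [clA e e0|h B].
  have [|a [Aa xa]] := clA (ball x e); first exact: nbhsx_ballx.
  by exists a => //; move: xa; rewrite -ball_normE.
move=> /nbhs_ballP[e /= e0 eB]; have [a Aa xa] := h e e0.
by exists a; split=> //; apply: eB; rewrite -ball_normE.
Qed.

Lemma closure_add K : add_closed K -> add_closed (closure K).
Proof.
move=> KD x y /closureP Kx /closureP Ky; apply/closureP => e e0.
have [a Ka xa] := Kx (e / 2) (divr_gt0 e0 (ltr0Sn _ _)).
have [b Kb yb] := Ky (e / 2) (divr_gt0 e0 (ltr0Sn _ _)).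
exists (a + b); first exact: KD.
by rewrite opprD addrACA normm_lt_split.
Qed.

Lemma minkowski_sum_set1E A u x :
  minkowski_sum A [set - u] x <-> A (u + x).
Proof.
split=> [[a Aa [_ -> <-]]|Aux]; first by rewrite [a - u]addrC addNKr.
by exists (u + x) => //; exists (- u) => //; rewrite addrAC subrr add0r.
Qed.

Lemma convex_translate A u : convex_set A ->
  convex_set (minkowski_sum A [set - u]).
Proof.
move=> cA; apply: convex_set_intro => t x y t01.
move=> /minkowski_sum_set1E Ax /minkowski_sum_set1E Ay.
apply/minkowski_sum_set1E.
suff -> : u + (t *: x + (1 - t) *: y) = t *: (u + x) + (1 - t) *: (u + y).
  exact: convex_set_comb.
by rewrite !scalerDr addrACA -scalerDl [t + _]addrC subrK scale1r.
Qed.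

(** The distance to a convex cone is sublinear, so Hahn-Banach extends it to a
    functional that is nonpositive on the cone and positive at [x0]; being
    below the norm makes it continuous. *)
Theorem cone_separation K x0 : is_cone K -> add_closed K -> ~ closure K x0 ->
  exists2 f : {linear E -> R^o}, continuous f &
    (forall k, K k -> f k <= 0) /\ 0 < f x0.
Proof.
move=> Kc KD x0K; have K0 := is_cone0 Kc; have [_ KZ] := Kc.
pose D x := [set `|x - k| | k in K].
pose q x := inf (D x).
have Dinf x : has_inf (D x).
  split; first by exists `|x - 0|, 0.
  by exists 0 => _ [k _ <-].
have qle x k : K k -> q x <= `|x - k|.
  by move=> Kk; apply: ge_inf; [exact: (Dinf x).2|exists k].
have qge x m : (forall k, K k -> m <= `|x - k|) -> m <= q x.
  move=> h; apply: lb_le_inf; first exact: (Dinf x).1.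
  by move=> _ [k Kk <-]; exact: h.
have sq : sublinear q.
  split=> [x y|t x t0].
    rewrite -lerBlDr; apply/qge => k Kk; rewrite lerBlDr -lerBlDl.
    apply/qge => l Kl; rewrite lerBlDl.
    apply: le_trans (qle _ _ (KD _ _ Kk Kl)) _.
    by rewrite opprD addrACA ler_normD.
  rewrite -ler_pdivrMl//; apply/qge => k Kk; rewrite ler_pdivrMl//.
  have := qle (t *: x) (t *: k) (KZ _ _ (ltW t0) Kk).
  by rewrite -scalerBr normrZ gtr0_norm.
have [f fq fx0] := hahn_banach x0 sq.
have fnorm x : `|f x| <= `|x|.
  have le1 y : f y <= `|y|.
    by apply: le_trans (fq y) _; rewrite -[y in `|y|]subr0; exact: qle.
  by rewrite ler_norml le1 lerNl -linearN -normrN le1.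
exists f; last split=> [k Kk|].
- apply/linear_bounded_continuous/linear_boundedP.
  exists 1; split=> // r r1 x; apply: le_trans (fnorm x) _.
  by rewrite ler_peMl// ltW.
- by apply: le_trans (fq k) _; rewrite -(normr0 E) -(subrr k) qle.
- rewrite fx0; apply: contra_notT x0K; rewrite -leNgt => q0.
  apply/closureP => e e0.
  have [_ [k Kk <-] ke] := inf_adherent e0 (Dinf x0).
  by exists k => //; apply: lt_le_trans ke _; rewrite -/(q x0); lra.
Qed.

End Cones.

(** * Contingent cones and minimal points *)

Section Contingent.
Context {R : realType} {E : normedModType R}.
Implicit Types (A : set E) (u v : E).

(** The limit inferior of the difference quotients vanishes exactly when
    arbitrarily small steps have arbitrarily small quotients. *)
Lemma contingent_coneP A u v : contingent_cone A u v <->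
  forall e : R, 0 < e -> exists h : R,
    [/\ 0 < h, h < e & exists2 a, A a & `|u + h *: v - a| < e * h].
Proof.
rewrite /contingent_cone/= limf_einfE.
set g := (fun h : R => _); set S := (X in ereal_sup X).
have gE (h : R) : 0 < h -> g h = (edist_inf A (u + h *: v)%R * (h^-1)%:E)%E.
  by move=> h0; rewrite /g inver gt_eqF.
split=> [S0 e e0|H].
  apply: contrapT => noh.
  have : (e%:E <= ereal_sup S)%E.
    apply: le_trans (ereal_sup_ubound _); last first.
      exists [set h | 0 < h < e] => //=.
      near=> h; apply/andP; split; near: h; first exact: nbhs_right_gt.
      exact: nbhs_right_lt.
    apply: le_ereal_inf_tmp => _ [h /= /andP[h0 he] <-].
    rewrite gE// lee_pdivlMr// edist_inf_norm.
    apply: le_ereal_inf_tmp => _ [a Aa <-]; rewrite -EFinM lee_fin leNgt.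
    apply/negP => ha; apply: noh; exists h; split=> //.
    by exists a.
  by rewrite S0 lee_fin leNgt e0.
apply/eqP; rewrite eq_le; apply/andP; split; last first.
  apply: le_trans (ereal_sup_ubound _); last first.
    by exists [set h | 0 < h] => //=; exact: nbhs_right_gt.
  apply: le_ereal_inf_tmp => _ [h /= h0 <-].
  by rewrite gE// lee_pdivlMr// mul0e edist_inf_ge0.
apply: ge_ereal_sup => _ [V V0 <-]; apply/lee_addgt0Pr => e e0; rewrite add0e.
have [d /= d0 dV] := V0.
have de0 : 0 < Num.min d e by rewrite lt_min d0.
have [h [h0 hde [a Aa ha]]] := H _ de0.
move: hde ha; rewrite lt_min => /andP[hd _] ha.
apply: le_trans (ereal_inf_lbound _) _.
  exists h => //; apply: dV => //=.
  by rewrite sub0r normrN gtr0_norm.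
rewrite gE// lee_pdivrMr// edist_inf_norm.
apply: le_trans (ereal_inf_lbound _) _; first by exists a.
rewrite -EFinM lee_fin ltW// (lt_le_trans ha)// ler_wpM2r ?(ltW h0)//.
by rewrite ge_min lexx orbT.
Unshelve. all: by end_near. Qed.

Lemma contingent_cone_sub_closure A u :
  contingent_cone A u `<=` closure (cone (minkowski_sum A [set - u])).
Proof.
move=> v /contingent_coneP Av; apply/closureP => e e0.
have [h [h0 _ [a Aa ha]]] := Av e e0.
exists (h^-1 *: (a - u)).
  exists h^-1, (a - u); rewrite invr_ge0 ltW//; split=> //.
  by apply/minkowski_sum_set1E; rewrite addrC subrK.
rewrite -(ltr_pM2r h0) -[X in _ * X](gtr0_norm h0) mulrC -normrZ.
rewrite scalerBr scalerA divff ?gt_eqF// scale1r.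
by rewrite opprB addrA [_ + u]addrC.
Qed.

(** The reverse inclusion needs feasible points at small steps, whereas an
    element of the generated cone only provides one at some step: convexity
    moves it towards [u]. *)
Lemma contingent_cone_convex A u : convex_set A -> A u ->
  contingent_cone A u = closure (cone (minkowski_sum A [set - u])).
Proof.
move=> cA Au; apply/seteqP; split; first exact: contingent_cone_sub_closure.
move=> v /closureP clv; apply/contingent_coneP => e e0.
have [w cw vw] := clv e e0.
have [|d d0 dP] := cone_shrink (convex_translate (u := u) cA) _ cw.
  by apply/minkowski_sum_set1E; rewrite addr0.
pose h := Num.min d (e / 2).
have h0 : 0 < h by rewrite lt_min d0 divr_gt0.
exists h; split=> //; first by rewrite gt_min; apply/orP; right; lra.
exists (u + h *: w).
  by apply/minkowski_sum_set1E/dP; rewrite ltW//= ge_min lexx.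
rewrite opprD addrACA subrr add0r -scalerBr normrZ gtr0_norm//.
by rewrite mulrC ltr_pM2r.
Qed.

End Contingent.

Section MinimalPoints.
Context {R : realType} {Y : normedModType R}.
Variables (Yp : set Y).
Hypotheses (Yp_cone : is_cone Yp) (Yp_pointed : is_pointed Yp).
Implicit Types (A : set Y) (y k : Y).

Lemma pointed_eq0 y : Yp y -> Yp (- y) -> y = 0.
Proof.
move=> Yy YNy; suff : [set 0] y by [].
by rewrite -Yp_pointed; split=> //; exists (- y) => //; rewrite opprK.
Qed.

Lemma MinP A y : Min Yp A y <->
  A y /\ forall a, A a -> Yp (y - a) -> a = y.
Proof.
split=> [[Ay Ey]|[Ay h]]; split=> //.
  move=> a Aa Ya; suff : [set y] a by [].
  rewrite -Ey; split=> //; exists y => //; exists (- (y - a)).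
    by exists (y - a).
  by rewrite opprB addrC subrK.
apply/seteqP; split=> [a [Aa [_ -> [_ [k Yk <-] ya]]]|_ ->].
  by apply: h => //; rewrite -ya opprD opprK addrA subrr add0r.
split=> //; exists y => //; exists 0; last by rewrite addr0.
by exists 0; rewrite ?oppr0//; exact: is_cone0.
Qed.

Hypothesis Yp_convex : convex_set Yp.

(** A minimal point of [A + Yp] dominates its own component in [A], hence
    equals it; conversely a point of [A + Yp] below a minimal point of [A] has
    that point as [A]-component, and pointedness kills the other component. *)
Lemma Min_minkowski_sum A : Min Yp (minkowski_sum A Yp) = Min Yp A.
Proof.
have Y0 := is_cone0 Yp_cone; have YD := convex_cone_add Yp_cone Yp_convex.
have subA a : A a -> minkowski_sum A Yp a.
  by move=> Aa; exists a => //; exists 0; rewrite ?addr0.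
apply/seteqP; split=> y /MinP[].
  move=> [a Aa [k Yk <-{y}]] h.
  have ak : a = a + k.
    by apply: h; [exact: subA|rewrite [a + k]addrC addrK].
  by rewrite -ak in h *; apply/MinP; split=> // b Ab; exact/h/subA.
move=> Ay h; apply/MinP; split; first exact: subA.
move=> _ [a Aa [k Yk <-]] Yyak.
have ay : a = y.
  apply: h => //.
  have -> : y - a = y - (a + k) + k by rewrite opprD addrA subrK.
  exact: YD.
suff -> : k = 0 by rewrite addr0.
by apply: pointed_eq0 => //; move: Yyak; rewrite ay opprD addrA subrr add0r.
Qed.

End MinimalPoints.

(** * Cones with compact trace on the unit sphere *)

Section CompactSection.
Context {R : realType}.

(** The index is controlled through [n.+1%:R^-1] because the sequences below
    satisfy their estimates with that error. *)
Lemma compact_seq_cluster (E : normedModType R) (A : set E) (u : nat -> E) :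
  compact A -> (forall n, A (u n)) ->
  exists2 x, A x & forall e : R, 0 < e ->
    exists2 n, n.+1%:R^-1 < e & `|x - u n| < e.
Proof.
move=> cA Au.
have [|x [Ax clx]] := cA (u @ \oo) _.
  by exists 0%N => // n _; exact: Au.
exists x => // e e0.
have [|_ [[n /= ne <-] xn]] := clx [set u n | n in [set n | n.+1%:R^-1 < e]] _ _
    (nbhsx_ballx x e e0).
  have [N _ NP] := near_infty_natSinv_lt (PosNum e0).
  by exists N => // n Nn; exists n => //; exact: NP.
by exists n => //; move: xn; rewrite -ball_normE.
Qed.

Context {Y : normedModType R}.
Variable (K : set Y).
Hypotheses (K_cone : is_cone K) (K_neq0 : K <> [set 0]).
Hypothesis (K_sphere : compact (K `&` [set y | `|y| = 1])).
Implicit Types (y k s : Y).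

Lemma cone_direction k : K k -> k != 0 ->
  K (`|k|^-1 *: k) /\ `| `|k|^-1 *: k | = 1.
Proof.
move=> Kk k0; split; first by apply: K_cone.2 => //; rewrite invr_ge0.
by rewrite normrZ normfV normr_id mulVf ?normr_eq0.
Qed.

(** Every truncation of the cone is the image of a segment times its compact
    trace on the sphere under scaling. *)
Lemma cone_ball_compact (b : R) : compact (K `&` [set y | `|y| <= b]).
Proof.
pose f := (fun p : R^o * Y => p.1 *: p.2).
have cf : continuous f by move=> p; exact: scale_continuous.
suff -> : K `&` [set y | `|y| <= b] =
    f @` ([set t : R^o | 0 <= t <= b] `*` (K `&` [set y | `|y| = 1])).
  apply: continuous_compact; first exact: continuous_subspaceT.
  apply: compact_setX => //.
  suff -> : [set t : R^o | 0 <= t <= b] = `[0, b]%classic.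
    exact: segment_compact.
  by apply/seteqP; split=> t /=; rewrite in_itv.
have [s0 [Ks0 s01]] : exists s, K s /\ `|s| = 1.
  apply: contrapT => h; apply: K_neq0; apply/seteqP; split=> [k Kk|_ ->].
    apply/eqP/negP => /negP k0; apply: h.
    by exists (`|k|^-1 *: k); exact: cone_direction.
  exact: is_cone0.
apply/seteqP; split=> [k [Kk /= kb]|_ [[t s] [/= /andP[t0 tb] [Ks s1]] <-]].
  have [k0|k0] := eqVneq k 0.
    exists (0, s0); last by rewrite /f/= scale0r k0.
    by split=> //=; rewrite lexx/= -(normr0 Y) -k0.
  have [Ks s1] := cone_direction Kk k0.
  exists (`|k|, `|k|^-1 *: k); first by split=> //=; rewrite normr_ge0.
  by rewrite /f/= scalerA divff ?normr_eq0// scale1r.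
split; first exact: K_cone.2.
by rewrite /f/= normrZ s1 mulr1 ger0_norm.
Qed.

(** A point adherent to the cone is already adherent to a truncation, which is
    compact. *)
Lemma cone_closed : closure K `<=` K.
Proof.
move=> x /closureP Kx.
have cl : closed (K `&` [set y | `|y| <= `|x| + 1]).
  by apply: compact_closed => //; exact: cone_ball_compact.
have [] // := cl x; apply/closureP => e e0.
have [|k Kk xk] := Kx (Num.min e 1); first by rewrite lt_min e0 ltr01.
move: xk; rewrite lt_min => /andP[xe x1]; exists k => //; split=> //=.
by have := lerB_dist k x; rewrite distrC; lra.
Qed.

Hypotheses (K_convex : convex_set K) (K_pointed : is_pointed K).

(** If [A + K] recedes towards a direction of [- K], so does [A]: pointedness
    keeps the total [K]-component away from zero, so it can be normalised, and
    the normalised components accumulate on the sphere. *)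
Lemma closure_cone_minkowski_sum (A : set Y) k : K k -> k != 0 ->
  closure (cone (minkowski_sum A K)) (- k) ->
  exists2 s, K s /\ `|s| = 1 & closure (cone A) (- s).
Proof.
move=> Kk k0 /closureP clk.
have KD := convex_cone_add K_cone K_convex.
(* Otherwise the closed cone [K] would contain [- k]. *)
have [c c0 ck] : exists2 c : R, 0 < c & forall l, K l -> c <= `|k + l|.
  apply: contrapT => h; case/eqP: k0.
  apply: (pointed_eq0 K_pointed) => //; apply: cone_closed.
  apply/closureP => e e0; apply: contrapT => he; apply: h; exists e => // l Kl.
  rewrite leNgt; apply/negP => le; apply: he; exists l => //.
  by rewrite -normrN opprB opprK addrC.
have /choice[y_ yP] n : exists y, [/\ K y, c <= `|y| &
    exists2 a, cone A a & `|y + a| < n.+1%:R^-1].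
  have [|_ [l [_ [l0 [a Aa [b Kb <-]] ->]]] ll] := clk n.+1%:R^-1.
    by rewrite invr_gt0 ltr0Sn.
  have Klb : K (l *: b) by exact: K_cone.2.
  exists (k + l *: b); split; [exact: KD|exact: ck|].
  exists (l *: a); first by exists l, a.
  move: ll; rewrite -normrN opprB opprK scalerDr addrC.
  by rewrite [l *: a + _]addrC addrA.
have yn0 n : 0 < `|y_ n| by have [_ /(lt_le_trans c0)] := yP n.
have [s [Ks s1] scl] : exists2 s, (K `&` [set y | `|y| = 1]) s &
    forall e : R, 0 < e -> exists2 n, n.+1%:R^-1 < e &
      `|s - `|y_ n|^-1 *: y_ n| < e.
  apply: compact_seq_cluster => // n; have [Ky _ _] := yP n.
  by apply: cone_direction => //; rewrite -normr_gt0.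
exists s => //; apply/closureP => e e0.
have [|n ne sn] := scl (Num.min (e / 2) (c * (e / 2))).
  by rewrite lt_min !mulr_gt0// invr_gt0.
move: ne sn; rewrite !lt_min => /andP[_ ne] /andP[sn _].
have [_ cy [a ca ya]] := yP n.
exists (`|y_ n|^-1 *: a).
  case: ca => l [b [l0 Ab ->]]; exists (`|y_ n|^-1 * l), b.
  by rewrite scalerA mulr_ge0 ?invr_ge0.
have -> : - s - `|y_ n|^-1 *: a =
    - (s - `|y_ n|^-1 *: y_ n) - `|y_ n|^-1 *: (y_ n + a).
  by rewrite scalerDr !opprD opprK addrA addrK.
apply: normm_lt_split; rewrite normrN//.
rewrite normrZ normfV normr_id mulrC ltr_pdivrMr//.
apply: lt_trans ya _; apply: lt_le_trans ne _.
by rewrite mulrC ler_wpM2l// divr_ge0// ltW.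
Qed.

End CompactSection.

Section PerturbedMaps.
Context {R : realType} {U Y : normedModType R}.
Variable (K : set Y).
Hypotheses (K_cone : is_cone K) (K_neq0 : K <> [set 0]).
Hypothesis (K_sphere : compact (K `&` [set y | `|y| = 1])).

(** A tangent direction of [W] splits along [W = M + K].  When the
    [K]-components of the difference quotients stay bounded, they accumulate
    in [K] and what remains is tangent to [M]; when they do not, dividing by
    their norms makes everything else vanish and leaves a direction of [- K]
    in which the graph of [W] recedes. *)
Lemma contingent_derivative_decomposition (M W : U -> set Y) (y0 : Y) :
  dominated_near0 W M K -> (forall z, M z `<=` W z) ->
  (forall s, K s -> `|s| = 1 ->
    ~ closure (cone (minkowski_sum (graph W) [set - (0, y0)])) (0, - s)) ->
  forall z, contingent_derivative W (0, y0) z `<=`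
    minkowski_sum (contingent_derivative M (0, y0) z) K.
Proof.
move=> WM MW noK z y /contingent_coneP Wzy.
pose Q (e : R) (h : R) z' y' k := [/\ 0 < h < e, `|z - z'| < e, `|y - y'| < e,
  K k & M (h *: z') (y0 + h *: (y' - k))].
have QP (e : R) : 0 < e -> exists h z' y' k, Q e h z' y' k.
  move=> e0; have /nbhs_ballP[r /= r0 rP] := WM.
  have z1 : 0 < `|z| + 1 by rewrite ltr_wpDl.
  (* The last bound keeps the base point [h *: z'] where domination holds. *)
  pose d := Num.min e (Num.min 1 (r / (`|z| + 1))).
  have d0 : 0 < d by rewrite !lt_min e0 ltr01 divr_gt0.
  have [de d1 dr] : [/\ d <= e, d <= 1 & d <= r / (`|z| + 1)].
    by rewrite /d !ge_min !lexx !orbT.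
  have [h [h0 hd [[a1 a2] Wa]]] := Wzy d d0.
  rewrite prod_normE/= gt_max add0r => /andP[ha1 ha2].
  have hN0 : h != 0 by rewrite gt_eqF.
  have hz' : h *: (h^-1 *: a1) = a1 by rewrite scalerA divff// scale1r.
  have zz' : `|z - h^-1 *: a1| < d.
    rewrite -(ltr_pM2r h0) -[X in _ * X](gtr0_norm h0) mulrC -normrZ.
    by rewrite scalerBr hz'.
  have yy' : `|y - h^-1 *: (a2 - y0)| < d.
    rewrite -(ltr_pM2r h0) -[X in _ * X](gtr0_norm h0) mulrC -normrZ.
    by rewrite scalerBr scalerA divff// scale1r opprB addrA [_ + y0]addrC.
  have [|m Ma1 [l Kl ml]] := rP a1 _ a2 Wa.
    rewrite -ball_normE/= sub0r normrN -hz' normrZ gtr0_norm//.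
    apply: (@le_lt_trans _ _ (h * (`|z| + 1))).
      rewrite ler_pM2l//.
      have := lerB_dist (h^-1 *: a1) z; rewrite distrC.
      by move: zz' d1; lra.
    by rewrite -ltr_pdivlMr// (lt_le_trans hd).
  exists h, (h^-1 *: a1), (h^-1 *: (a2 - y0)), (h^-1 *: l).
  split; rewrite ?h0/=; [exact: lt_le_trans de|exact: lt_le_trans de|
    exact: lt_le_trans de| |].
    by apply: K_cone.2 => //; rewrite invr_ge0 ltW.
  rewrite hz' -scalerBr scalerA divff// scale1r -ml.
  by rewrite [m + l - y0]addrAC addrK addrCA subrr addr0.
have invS_gt0 n : 0 < n.+1%:R^-1 :> R by rewrite invr_gt0.
have [[b bP]|unb] := pselect (exists b : R, forall e : R, 0 < e ->
    exists h z' y' k, Q e h z' y' k /\ `|k| <= b).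
  have /choice[k_ kP] n : exists k, (exists h z' y', Q n.+1%:R^-1 h z' y' k) /\
      `|k| <= b.
    have [h [z' [y' [k [q kb]]]]] := bP _ (invS_gt0 n).
    by exists k; split=> //; exists h, z', y'.
  have [|k [Kk _] kcl] := compact_seq_cluster
      (cone_ball_compact K_cone K_neq0 K_sphere (b := b)) (u := k_).
    by move=> n; have [[h [z' [y' [_ _ _ Kk _]]]] kb] := kP n; split.
  exists (y - k); last by exists k => //; rewrite subrK.
  apply/contingent_coneP => e e0.
  have [|n ne kn] := kcl (e / 2); first by rewrite divr_gt0.
  have [[h [z' [y' [/andP[h0 hn] zz' yy' _ Mk]]]] _] := kP n.
  move: (n.+1%:R^-1) ne hn zz' yy' => i ie hi zz' yy'.
  exists h; split=> //; first lra.
  exists (h *: z', y0 + h *: (y' - k_ n)) => //.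
  rewrite prod_normE/= add0r opprD addrACA subrr add0r -!scalerBr !normrZ.
  rewrite gtr0_norm// [e * h]mulrC -maxr_pMr ?(ltW h0)// ltr_pM2l// gt_max.
  apply/andP; split; first lra.
  rewrite opprD opprK addrACA [- k + _]addrC -[k_ n - k]opprB.
  by apply: normm_lt_split; rewrite ?normrN//; lra.
(* In the unbounded case [|k_ n|^-1] falls below the error [n.+1%:R^-1]. *)
have /choice[k_ kP] n : exists k, (exists h z' y', Q n.+1%:R^-1 h z' y' k) /\
    n.+1%:R < `|k|.
  apply: contrapT => nk; apply: unb; exists n.+1%:R => e e0.
  have [|h [z' [y' [k [/andP[h0 hd] zz' yy' Kk Mk]]]]] :=
      QP (Num.min e n.+1%:R^-1).
    by rewrite lt_min e0 invS_gt0.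
  move: hd zz' yy'; rewrite !lt_min => /andP[he hn] /andP[ze zn] /andP[ye yn].
  exists h, z', y', k; split; first by split; rewrite ?h0.
  rewrite leNgt; apply/negP => nk'; apply: nk; exists k; split=> //.
  by exists h, z', y'; split; rewrite ?h0.
have kn0 n : 0 < `|k_ n|.
  by have [_ /(lt_trans _)] := kP n; apply; rewrite ltr0n.
have [|s [Ks s1] scl] := compact_seq_cluster K_sphere
    (u := fun n => `|k_ n|^-1 *: k_ n).
  move=> n; have [[h [z' [y' [_ _ _ Kk _]]]] _] := kP n.
  by apply: cone_direction => //; rewrite -normr_gt0.
case: (noK s Ks s1); apply/closureP => e e0.
(* [c] exceeds [|z| + 1] and [|y| + 2], the factors of [d] in the two
   components of the error. *)
pose c := `|z| + `|y| + 3.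
have z0 := normr_ge0 z; have y0' := normr_ge0 y.
have c3 : 3 <= c by rewrite /c; lra.
have c0 : 0 < c by lra.
pose d := Num.min 1 (e / c).
have d0 : 0 < d by rewrite lt_min ltr01 divr_gt0.
have d1 : d <= 1 by rewrite ge_min lexx.
have dc : d * c <= e by rewrite -ler_pdivlMr// ge_min lexx orbT.
have [n nd sn] := scl d d0.
have [[h [z' [y' [/andP[h0 hn] zz' yy' Kk Mk]]]] nk] := kP n.
have kinv : `|k_ n|^-1 < d.
  apply: lt_trans nd; rewrite ltf_pV2// posrE ?ltr0n//.
exists (`|k_ n|^-1 *: (z', y' - k_ n)).
  exists (`|k_ n|^-1 * h^-1), (h *: z', h *: (y' - k_ n)); split.
  - by rewrite mulr_ge0 ?invr_ge0// ltW.
  - by apply/minkowski_sum_set1E; rewrite /graph/= add0r; exact: MW.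
  - rewrite -scalerA; congr (_ *: _).
    rewrite -[(h *: z', _)]/(h *: (z', y' - k_ n)) scalerA.
    by rewrite mulVf ?gt_eqF// scale1r.
rewrite prod_normE/= sub0r normrN gt_max normrZ normfV normr_id.
have zz1 := lt_le_trans (lt_trans zz' nd) d1.
have yy1 := lt_le_trans (lt_trans yy' nd) d1.
have zd : `|z'| <= `|z| + 1 by have := lerB_dist z' z; rewrite distrC; lra.
have yd : `|y'| <= `|y| + 1 by have := lerB_dist y' y; rewrite distrC; lra.
have ki0 : 0 <= `|k_ n|^-1 by rewrite invr_ge0.
apply/andP; split.
  apply: (@le_lt_trans _ _ (d * (`|z| + 1))).
    by apply: ler_pM => //; exact: ltW.
  by apply: lt_le_trans dc; rewrite ltr_pM2l// /c; lra.
have -> : - s - `|k_ n|^-1 *: (y' - k_ n) =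
    - (s - `|k_ n|^-1 *: k_ n) - `|k_ n|^-1 *: y'.
  by rewrite scalerBr !opprD !opprK addrA addrAC.
apply: le_lt_trans (ler_normB _ _) _; rewrite normrN normrZ normfV normr_id.
apply: (@lt_le_trans _ _ (d + d * (`|y| + 1))).
  by apply: ltr_leD => //; apply: ler_pM => //; exact: ltW.
by apply: le_trans dc; rewrite -[X in X + _]mulr1 -mulrDr ler_pM2l// /c; lra.
Qed.

End PerturbedMaps.

(** * Excluded recession directions and the upper value map *)

Section Recession.
Context {R : realType} {Y : normedModType R}.
Variable (Yp : set Y).
Implicit Types (A K T : set Y) (y s v : Y).

(** If [v] is nonzero, the base elements on the rays of [v] and [- v] have a
    convex combination equal to [0]. *)
Lemma base_pointed (E : normedModType R) (T K : set E) (v : E) :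
  is_base T K -> K v -> K (- v) -> v = 0.
Proof.
move=> [_ cT _ T0 ->] [l [a [l0 Ta va]]] [m [b [m0 Tb vb]]].
apply: contrapT => /eqP vN0.
have l_gt0 : 0 < l.
  by rewrite lt_neqAle l0 andbT; apply: contra_neq vN0 => l_eq0;
     rewrite va -l_eq0 scale0r.
have lm0 : 0 < l + m by rewrite ltr_wpDr.
apply: T0; apply: subset_closure.
have -> : 0 = l / (l + m) *: a + (1 - l / (l + m)) *: b.
  have -> : 1 - l / (l + m) = (l + m)^-1 * m by field; rewrite gt_eqF.
  by rewrite [l / _]mulrC -!scalerA -scalerDr -va -vb addrN scaler0.
apply: convex_set_comb => //.
by rewrite divr_ge0 ?ler_pdivrMr ?mul1r ?lerDl// ltW.
Qed.

(** A ball around [0] contains small multiples of both [v] and [- v]. *)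
Lemma pointed_interior0 K v : is_cone K -> is_pointed K -> v != 0 ->
  ~ interior K 0.
Proof.
move=> Kc Kp v0 /nbhs_ballP[r /= r0 rK].
have v_gt0 : 0 < `|v| by rewrite normr_gt0.
pose w := (r / 2 / `|v|) *: v.
have t0 : 0 < r / 2 / `|v| by rewrite !divr_gt0.
have wr : `|w| < r.
  by rewrite normrZ gtr0_norm// divfK ?gt_eqF//; lra.
have w0 : w = 0.
  apply: (pointed_eq0 Kp); apply: rK; rewrite -ball_normE/= sub0r ?opprK//.
  by rewrite normrN.
by move/eqP: w0; rewrite scaler_eq0 (gt_eqF t0) (negPf v0).
Qed.

(** The interior of the cone that defines Henig global efficiency contains [s],
    hence the negatives of all generators of directions close to [- s]. *)
Lemma GHe_not_recession A y s : GHe Yp A y -> Yp s -> s != 0 ->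
  ~ closure (cone (minkowski_sum A [set - y])) (- s).
Proof.
move=> [_ [K [Kc Kp YK AK]]] Ys s0 cls.
have Ks : interior K s by apply: YK; split=> //; exact/eqP.
have [r /= r0 rK] : nbhs_ball s (interior K).
  by apply/nbhs_ballP/nbhs_interior.
have /closureP/(_ r r0)[_ [l [a [l0 Aa ->]]] sl] := cls.
have Kla : interior K (- (l *: a)).
  by apply: rK; rewrite -ball_normE/= opprK -normrN opprD.
have [l_eq0|lN0] := eqVneq l 0.
  move: Kla; rewrite l_eq0 scale0r oppr0.
  exact: (@pointed_interior0 K s).
have l_gt0 : 0 < l by rewrite lt_neqAle eq_sym lN0.
suff : (set0 : set Y) a by [].
rewrite -AK; split=> //; exists (- a); last by rewrite opprK.
have /nbhs_ballP[d /= d0 dK] := Kla.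
apply/nbhs_ballP; exists (d / l) => [|x /=]; first exact: divr_gt0.
rewrite -ball_normE/= ltr_pdivlMr// mulrC => ax.
rewrite -[x](scalerK lN0); apply: Kc.2; first by rewrite invr_ge0.
apply: dK; rewrite -ball_normE/=.
by rewrite -scalerN -scalerBr normrZ gtr0_norm.
Qed.

Lemma He_not_recession A y s : He Yp A y -> Yp s -> s != 0 ->
  ~ closure (cone (minkowski_sum A [set - y])) (- s).
Proof.
move=> [_ [T [[_ _ _ _ YpT] [e e0 H]]]] Ys s0 cls.
suff : [set 0] (- s) by move/eqP; rewrite oppr_eq0; apply/negP.
rewrite -H; split=> //; exists s => //; apply: subset_closure.
move: Ys; rewrite YpT => -[l [a [l0 Ta ->]]].
exists l, a; split=> //; exists a => //; exists 0; last by rewrite addr0.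
by exists 0; rewrite ?scaler0// /unit_ball/= normr0.
Qed.

(** When [Yp] minus the origin is open, [Yp] can itself serve as the enlarged
    cone, and plain minimality is Henig global efficiency. *)
Lemma open_Min_GHe A y : is_cone Yp -> is_pointed Yp -> Yp <> [set 0] ->
  open (Yp `\ 0) -> Min Yp A y -> GHe Yp A y.
Proof.
move=> Yc Yptd Y0 Yo /(MinP Yc)[Ay ymin]; split=> //; exists Yp; split=> //.
  move=> s Ys; have : nbhs s (Yp `\ 0) by apply: open_nbhs_nbhs.
  by apply: filterS => x [].
apply/seteqP; split=> // a [/minkowski_sum_set1E Aa [i Yi ia]].
have ya : y + a = y.
  apply: ymin => //; rewrite opprD addrA subrr add0r -ia opprK.
  exact: interior_subset.
have i0 : i = 0.
  have a0 : a = 0 by apply: (addrI y); rewrite addr0.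
  by rewrite -[i]opprK ia a0 oppr0.
apply: Y0; apply/seteqP; split=> [s Ys|_ ->]; last exact: is_cone0.
apply: contrapT => /eqP s0; apply: (pointed_interior0 Yc Yptd s0).
by rewrite -i0.
Qed.

End Recession.

Section ValueMap.
Context {R : realType} {X Y Z : normedModType R}.
Variables (Omega : set X) (F : X -> set Y) (G : X -> set Z).
Variables (Yp : set Y) (Zp : set Z).
Hypotheses (Yp_cone : is_cone Yp) (Yp_convex : convex_set Yp).
Hypotheses (Zp_cone : is_cone Zp) (Zp_convex : convex_set Zp).
Hypothesis F_convex : cone_convex_on Omega F Yp.
Hypothesis G_convex : cone_convex_on Omega G Zp.

Let V := value_map Omega F G Zp.
Let W := upper_value_map Omega F G Yp Zp.

Lemma feasibleE z x :
  feasible Omega G Zp z x <-> Omega x /\ minkowski_sum (G x) Zp z.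
Proof.
split=> [[Ox [g [Gg [_ -> [_ [k Zk <-] zk]]]]]|[Ox [g Gg [k Zk <-]]]].
  by split=> //; exists g => //; exists k; rewrite // -zk subrK.
split=> //; exists g; split=> //; exists (g + k) => //.
by exists (- k); [exists k|rewrite addrK].
Qed.

(** The graph of the upper value map is a fibre product of the epigraphs of
    [F] and [G] over [Omega]; its convexity and its monotonicity are read off
    from this description. *)
Lemma upper_value_mapE z y : W z y <->
  exists x, [/\ Omega x, minkowski_sum (G x) Zp z & minkowski_sum (F x) Yp y].
Proof.
split=> [[v [x /feasibleE[Ox Gz] Fv] [k Yk <-]]|[x [Ox Gz [v Fv [k Yk <-]]]]].
  by exists x; split=> //; exists v => //; exists k.
by exists v; [exists x => //; exact/feasibleE|exists k].
Qed.

Lemma convex_graph_upper_value_map : convex_set (graph W).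
Proof.
apply: convex_set_intro => t [z y] [z' y'] t01.
rewrite /graph/= => /upper_value_mapE[x [Ox Gz Fy]].
move=> /upper_value_mapE[x' [Ox' Gz' Fy']].
apply/upper_value_mapE; exists (t *: x + (1 - t) *: x').
have [Ot Gt] := @convex_set_comb _ _ _ G_convex t (x, z) (x', z') t01
  (conj Ox Gz) (conj Ox' Gz').
by have [_ Ft] := @convex_set_comb _ _ _ F_convex t (x, y) (x', y') t01
  (conj Ox Fy) (conj Ox' Fy').
Qed.

Lemma minkowski_sum_cone_add (E : normedModType R) (A K : set E) a k :
  is_cone K -> convex_set K -> minkowski_sum A K a -> K k ->
  minkowski_sum A K (a + k).
Proof.
move=> Kc cK [b Ab [l Kl <-]] Kk; exists b => //; exists (l + k).
  exact: convex_cone_add.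
by rewrite addrA.
Qed.

Lemma upper_value_map_add z y z' y' :
  W z y -> Zp z' -> Yp y' -> W (z + z') (y + y').
Proof.
move=> /upper_value_mapE[x [Ox Gz Fy]] Zz' Yy'; apply/upper_value_mapE.
by exists x; split=> //; exact: minkowski_sum_cone_add.
Qed.

Lemma value_map_sub_upper z : V z `<=` W z.
Proof.
by move=> y Vy; exists y => //; exists 0; rewrite ?addr0//; exact: is_cone0.
Qed.

Lemma upper_value_map_translate y0 :
  minkowski_sum (W 0) [set - y0] =
  minkowski_sum (minkowski_sum (V 0) [set - y0]) Yp.
Proof.
apply/seteqP; split=> y.
  move=> /minkowski_sum_set1E[v Vv [k Yk vk]].
  exists (v - y0); first by exists v => //; exists (- y0).
  by exists k; rewrite // addrAC vk addrC addKr.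
move=> [_ [v Vv [_ -> <-]] [k Yk <-]]; apply/minkowski_sum_set1E.
by exists v => //; exists k; rewrite // [v - y0]addrC addrA addNKr.
Qed.

(** The Slater point stays feasible under small perturbations, so one value of
    [F] there serves all of them. *)
Lemma slater_ball : slater Omega G Zp ->
  (forall z, feasible Omega G Zp z `<=` dom_on Omega F) ->
  exists2 r : R, 0 < r & exists y1, forall z, `|z| < r -> W z y1.
Proof.
move=> [x1 Ox1 [g [Gg [i Zi ig]]]] fdom.
have /nbhs_ballP[r /= r0 rZ] := Zi.
have fx z : `|z| < r -> feasible Omega G Zp z x1.
  move=> zr; apply/feasibleE; split=> //; exists g => //.
  exists (i + z); last by rewrite -ig addKr.
  by apply: rZ; rewrite -ball_normE/= opprD addrA subrr add0r normrN.
have [|_ [y1 Fy1]] := fdom 0 x1; first by apply: fx; rewrite normr0.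
exists r => //; exists y1 => z zr; apply: value_map_sub_upper.
by exists x1 => //; exact: fx.
Qed.

Variable y0 : Y.
Hypothesis W0y0 : W 0 y0.

Let T := closure (cone (minkowski_sum (graph W) [set - (0, y0)])).

Let translate0 z y : W z y ->
  minkowski_sum (graph W) [set - (0, y0)] (z, y - y0).
Proof.
by move=> Wzy; apply/minkowski_sum_set1E; rewrite /graph/= add0r addrC subrK.
Qed.

Lemma recession_orthant z y : Zp z -> Yp y -> T (z, y).
Proof.
move=> Zz Yy; apply/subset_closure/sub_cone/minkowski_sum_set1E.
by have := upper_value_map_add W0y0 Zz Yy.
Qed.

(** Slater's condition makes all small perturbations feasible at a common
    value, which absorbs the [Z]-component of an approximating direction at a
    vanishing cost: the fibre over [0] of the closed cone is generated by the
    fibre of the graph. *)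
Lemma tangent_fibre0 : slater Omega G Zp ->
  (forall z, feasible Omega G Zp z `<=` dom_on Omega F) ->
  forall y, T (0, y) -> closure (cone (minkowski_sum (W 0) [set - y0])) y.
Proof.
move=> sl fdom y /closureP Ty; apply/closureP => e e0.
have [r r0 [y1 y1P]] := slater_ball sl fdom.
pose q := y1 - y0; have q1 : 0 < `|q| + 1 by rewrite ltr_wpDl.
pose d := e / 2 / (`|q| + 1); have d0 : 0 < d by rewrite !divr_gt0.
have dq : d * `|q| < e / 2.
  by rewrite /d mulrAC ltr_pdivrMr// ltr_pM2l ?divr_gt0// ltrDl.
have [|[a b] Cab] := Ty (Num.min (e / 2) (d * r)).
  by rewrite lt_min !mulr_gt0// invr_gt0.
rewrite prod_normE/= sub0r normrN gt_max !lt_min.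
move=> /andP[/andP[_ adr] /andP[yb _]].
have Cq : cone (minkowski_sum (graph W) [set - (0, y0)])
    (d *: (- (d^-1 *: a), q)).
  exists d, (- (d^-1 *: a), q); split; [exact: ltW| |by []].
  apply: translate0; apply: y1P.
  by rewrite normrN normrZ gtr0_norm ?invr_gt0// ltr_pdivrMl.
have [l [[z w] [l0 /minkowski_sum_set1E Wzw [lz lw]]]] :=
  cone_add (convex_translate convex_graph_upper_value_map) Cab Cq.
have lz0 : l *: z = 0.
  by rewrite -lz scalerN scalerA divff ?gt_eqF// scale1r subrr.
exists (b + d *: q).
  have [l_eq0|lN0] := eqVneq l 0.
    exists 0, (y0 - y0); split=> //; last by rewrite lw l_eq0 !scale0r.
    by exists y0 => //; exists (- y0).
  have z0 : z = 0 by apply/eqP; move/eqP: lz0; rewrite scaler_eq0 (negPf lN0).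
  exists l, w; split=> //; apply/minkowski_sum_set1E.
  by move: Wzw; rewrite /graph/= z0 addr0.
rewrite opprD addrA; apply: normm_lt_split => //.
by rewrite normrN normrZ gtr0_norm.
Qed.

(** Bipolar theorem: a multiplier is, up to sign, a continuous functional that
    is nonpositive on the translated graph, and these functionals separate
    points from the closed convex cone it generates. *)
Lemma lagrange_processE z y :
  lagrange_process Omega F G Yp Zp y0 (- z) y <-> T (z, y).
Proof.
split=> [L|Tzy [p q] [/= cp cq _ pq]]; last first.
  have le0 z' y' : cone (minkowski_sum (graph W) [set - (0, y0)]) (z', y') ->
      0 <= p z' + q y'.
    move=> [l [[a b] [l0 /minkowski_sum_set1E Wab [-> ->]]]].
    rewrite !linearZ/= -mulrDr mulr_ge0//.
    by have := pq _ _ Wab; rewrite add0r linearD/=; lra.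
  have cg : continuous (fun x : Z * Y => p x.1 + q x.2 : R^o).
    move=> x; apply: (@continuousD _ R^o _ (fun x => p x.1) (fun x => q x.2)).
      by apply: (@continuous_comp _ _ _ fst p); [exact: cvg_fst|exact: cp].
    by apply: (@continuous_comp _ _ _ snd q); [exact: cvg_snd|exact: cq].
  have cl : closed [set x : Z * Y | 0 <= p x.1 + q x.2].
    by apply: (closed_comp (fun x _ => cg x) (@closed_ge R 0)).
  suff : [set x : Z * Y | 0 <= p x.1 + q x.2] (z, y).
    by rewrite /= linearN/=; lra.
  by apply: cl; apply: closureS Tzy => -[a b]; exact: le0.
apply: contrapT => nT.
have [||f cf [fK f0]] := @cone_separation _ _
  (cone (minkowski_sum (graph W) [set - (0, y0)])) (z, y) _ _ nT.
- by apply: cone_is_cone; exists (0, y0 - y0); exact: translate0.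
- exact/cone_add/convex_translate/convex_graph_upper_value_map.
have fE a b : f (a, b) = f (a, 0) + f (0, b).
  by rewrite -linearD; congr (f _); congr pair; rewrite ?addr0 ?add0r.
pose p a : R^o := - f (a, 0).
pose q b : R^o := - f (0, b).
have lp : linear p.
  move=> t a b; have -> : p (t *: a + b) = - f (t *: (a, 0) + (b, 0)).
    by congr (- f _); congr pair; rewrite /= scaler0 addr0.
  by rewrite linearP opprD scalerN.
have lq : linear q.
  move=> t a b; have -> : q (t *: a + b) = - f (t *: (0, a) + (0, b)).
    by congr (- f _); congr pair; rewrite /= scaler0 addr0.
  by rewrite linearP opprD scalerN.
have cp : continuous p.
  move=> a; apply: (@continuousN _ R^o _ (fun a => f (a, 0))).
  apply: (@continuous_comp _ _ _ (fun a : Z => (a, 0 : Y)) f); last exact: cf.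
  by apply: cvg_pair => //; exact: cvg_cst.
have cq : continuous q.
  move=> b; apply: (@continuousN _ R^o _ (fun b => f (0, b))).
  apply: (@continuous_comp _ _ _ (fun b : Y => (0 : Z, b)) f); last exact: cf.
  by apply: cvg_pair => //; exact: cvg_cst.
pose P := HB.pack_for {linear Z -> R^o} p (GRing.isLinear.Build R Z R^o _ _ lp).
pose Q := HB.pack_for {linear Y -> R^o} q (GRing.isLinear.Build R Y R^o _ _ lq).
have fW a b : W a b -> f (a, 0) + f (0, b) <= f (0, y0).
  move=> /translate0/sub_cone/fK.
  have -> : f (a, b - y0) = f (a, 0) + f (0, b) - f (0, y0); last by lra.
  rewrite -linearD -linearB; congr (f _); congr pair.
    by rewrite /= addr0 subr0.
  by rewrite /= add0r.
have : P (- z) <= Q y.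
  apply: L (P, Q) _; split=> //=.
    move=> _ _ [a Za <-] [_ -> [_ [b Yb <-] <-]].
    have := fW _ _ (upper_value_map_add W0y0 Za Yb).
    have := linearN P a; have := linearB Q y0 b; have := linearD Q y0 b.
    by rewrite /= add0r /p /q; lra.
  move=> a b Wab; have := fW _ _ Wab.
  by rewrite /p /q; lra.
by have := linearN P z; move: f0; rewrite fE /= /p /q; lra.
Qed.

End ValueMap.

(** * Derivative of the minimal map *)

Theorem theorem5p8 (R : realType) (X Y Z : normedModType R)
    (Yp : set Y) (Zp : set Z)
    (Yp_cone : is_cone Yp) (Yp_convex : convex_set Yp)
    (Yp_proper : is_proper Yp) (Yp_solid : is_solid Yp)
    (Yp_pointed : is_pointed Yp)
    (Zp_cone : is_cone Zp) (Zp_convex : convex_set Zp)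
    (Zp_proper : is_proper Zp) (Zp_solid : is_solid Zp)
    (Omega : set X) (Omega_neq0 : Omega !=set0)
    (Omega_convex : convex_set Omega)
    (F : X -> set Y) (G : X -> set Z)
    (F_convex : cone_convex_on Omega F Yp)
    (G_convex : cone_convex_on Omega G Zp)
    (feasible_dom : forall z : Z, feasible Omega G Zp z `<=` dom_on Omega F)
    (y0 : Y) (y0_value : value_map Omega F G Zp 0 y0)
    (y0_minimal : minimal_map Omega F G Yp Zp 0 y0)
    (slater_cond : slater Omega G Zp)
    (Yp_sphere_compact : compact (Yp `&` [set y | `|y| = 1]))
    (V_dominated : dominated_near0 (value_map Omega F G Zp)
                     (minimal_map Omega F G Yp Zp) Yp)
    (abcd :
      [\/ exists T : set (Z * Y),
            is_base T (graph (lagrange_process Omega F G Yp Zp y0)) /\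
            bounded_set T,
          open (Yp `\ 0),
          GHe Yp (value_map Omega F G Zp 0) y0
        | He Yp (value_map Omega F G Zp 0) y0]) :
  forall z : Z,
  Min Yp (contingent_derivative (minimal_map Omega F G Yp Zp) (0, y0) z) =
  Min Yp (lagrange_process Omega F G Yp Zp y0 (- z)).
Proof.
move=> z; set V := value_map Omega F G Zp in y0_value abcd V_dominated *.
set M := minimal_map Omega F G Yp Zp in y0_minimal V_dominated *.
set L := lagrange_process Omega F G Yp Zp y0 in abcd *.
pose W := upper_value_map Omega F G Yp Zp.
have Yp_neq0 := Yp_proper.1.
have YpD := convex_cone_add Yp_cone Yp_convex.
have VW : forall u, V u `<=` W u by exact: value_map_sub_upper.
have W0y0 : W 0 y0 by exact: VW.
have MW u : M u `<=` W u by move=> y [Vy _]; exact: VW.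
pose T := closure (cone (minkowski_sum (graph W) [set - (0, y0)])).
have LT u y : L (- u) y <-> T (u, y) by exact: lagrange_processE.
have DWT u : contingent_derivative W (0, y0) u = L (- u).
  apply/seteqP; split=> y.
    rewrite /contingent_derivative/= contingent_cone_convex//.
      by move=> Ty; exact/LT.
    exact: convex_graph_upper_value_map.
  move=> /LT Ty; rewrite /contingent_derivative/= contingent_cone_convex//.
  exact: convex_graph_upper_value_map.
have TD : add_closed T.
  by apply/closure_add/cone_add/convex_translate/convex_graph_upper_value_map.
have TY u y : Zp u -> Yp y -> T (u, y).
  by move=> *; exact: recession_orthant.
(* The one place where (a)-(d) enter: no direction of [- Yp] lies in the
   fibre of [T] over [0]. *)
have noK s : Yp s -> `|s| = 1 -> ~ T (0, - s).
  move=> Ys s1 Ts.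
  have s0 : s != 0 by rewrite -normr_eq0 s1 oner_eq0.
  have rec : GHe Yp (V 0) y0 \/ He Yp (V 0) y0 -> False.
    have cl0 : closure (cone (minkowski_sum (W 0) [set - y0])) (- s).
      by apply: tangent_fibre0 Ts.
    rewrite upper_value_map_translate in cl0.
    have [r [Yr r1] cl] := closure_cone_minkowski_sum Yp_cone Yp_neq0
      Yp_sphere_compact Yp_convex Yp_pointed Ys s0 cl0.
    have r0 : r != 0 by rewrite -normr_eq0 r1 oner_eq0.
    by case=> [/GHe_not_recession|/He_not_recession] /(_ _ Yr r0).
  case: abcd => [[B [BL _]]|Yo|Hy|Hy].
  - move/eqP: s0; apply.
    suff /(congr1 snd) : (0, s) = 0 :> Z * Y by [].
    apply: (base_pointed BL); rewrite /graph/=.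
      by rewrite -oppr0; apply/LT/TY => //; exact: is_cone0.
    exact/LT.
  - by apply: rec; left; exact: open_Min_GHe.
  - by apply: rec; left.
  - by apply: rec; right.
have WM : dominated_near0 W M Yp.
  move: V_dominated; rewrite /dominated_near0.
  apply: filterS => u VM _ [v Vv [k Yk <-]].
  have [m Mm [l Yl <-]] := VM v Vv.
  by exists m => //; exists (l + k); rewrite ?addrA//; exact: YpD.
have DM : contingent_derivative W (0, y0) z =
    minkowski_sum (contingent_derivative M (0, y0) z) Yp.
  apply/seteqP; split=> [|_ [y DMy [k Yk <-]]].
    exact: contingent_derivative_decomposition.
  rewrite DWT; apply/LT.
  have -> : (z, y + k) = (z, y) + (0, k) by congr pair; rewrite addr0.
  apply: TD; last by apply: TY => //; exact: is_cone0.
  have : closure (cone (minkowski_sum (graph M) [set - (0, y0)])) (z, y).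
    exact: contingent_cone_sub_closure.
  apply: closureS => _ [l [a [l0 /minkowski_sum_set1E Ma ->]]].
  by exists l, a; split=> //; apply/minkowski_sum_set1E; exact: MW.
by rewrite -DWT DM Min_minkowski_sum.
Qed.
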